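(* Let $(R,\mathfrak{m},\mathscr{k})$ be a $d$-dimensional (Noetherian) local ring. Then $R$ is Buchsbaum if and only if there exists a binary numerical function $\varphi_R:(\mathbb{N}\cup\{\infty\})^2\to\mathbb{N}\cup\{\infty\}$ such that for any system of parameters $\mathbf{x}=x_1,\dots,x_d$ of $R$ and any $d$-tuple $\mathbf{y}=y_1,\dots,y_d\in R$, \[ \operatorname{ord}_R(x_1y_1+\cdots+x_dy_d)\leq\varphi_R\big(\ell_R(R/\mathbf{x}R),\ \operatorname{ord}_{R/((x_1,\dots,x_{d-1}):\mathfrak{m})}(y_d)\big). \]
   Context: An $n$-ary numerical function is a function $\varphi:(\mathbb{N}\cup\{\infty\})^n\to\mathbb{N}\cup\{\infty\}$ with $\varphi(a_1,\dots,a_n)=\infty$ iff some $a_i=\infty$. For a local ring $(S,\mathfrak{n})$, $\operatorname{ord}_S(x)=\sup\{n\mid x\in\mathfrak{n}^n\}$; for an ideal $J\subseteq R$, $\operatorname{ord}_{R/J}(y)$ is the order of the image of $y$ in $R/J$. $R$ is Buchsbaum if for every system of parameters $x_1,\dots,x_d$ and every $1\le i\le d$ one has $(x_1,\dots,x_{i-1}):x_i=(x_1,\dots,x_{i-1}):\mathfrak{m}$ (equivalently, $\ell_R(R/I)-e(I)$ is independent of the parameter ideal $I$, where $e(I)$ is the multiplicity). *)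

(* Defs.v *)
From mathcomp Require Import all_boot all_order all_algebra.
From Stdlib Require Import ClassicalEpsilon.
Set Implicit Arguments. Unset Strict Implicit. Unset Printing Implicit Defensive.
Import GRing.Theory.
Local Open Scope ring_scope.

(* N ∪ {∞} is represented by option nat, None = ∞. *)
Definition le_inf (a b : option nat) : Prop :=
  match a, b with
  | _, None => True
  | None, Some _ => False
  | Some m, Some n => (m <= n)%N
  end.

Definition numerical2 (phi : option nat -> option nat -> option nat) : Prop :=
  forall a b, phi a b = None <-> (a = None \/ b = None).

Definition decb (P : Prop) : bool :=
  if excluded_middle_informative P then true else false.

Lemma decbP (P : Prop) : decb P <-> P.
Proof. by rewrite /decb; case: excluded_middle_informative. Qed.

Definition sup_nat (P : nat -> Prop) : option nat :=
  match excluded_middle_informative (exists b, forall n, P n -> (n <= b)%N) with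
  | left H =>
      Some (@ex_minn (fun b => decb (forall n, P n -> (n <= b)%N))
              (let: ex_intro b Hb := H in ex_intro _ b (proj2 (decbP _) Hb)))
  | right _ => None
  end.

Section CommAlg.
Variable R : comNzRingType.

Definition is_ideal (I : R -> Prop) : Prop :=
  I 0 /\ (forall a b, I a -> I b -> I (a + b)) /\ (forall r a, I a -> I (r * a)).

Definition subsetR (I J : R -> Prop) : Prop := forall r, I r -> J r.
Definition eqsetR (I J : R -> Prop) : Prop := forall r, I r <-> J r.
Definition psubsetR (I J : R -> Prop) : Prop := subsetR I J /\ ~ subsetR J I.

Definition ideal_gen (S : R -> Prop) : R -> Prop :=
  fun r => forall I, is_ideal I -> subsetR S I -> I r.

Definition seq_ideal (s : seq R) : R -> Prop :=
  ideal_gen (fun r => exists2 i, (i < size s)%N & r = s`_i).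

Definition add_ideal (I J : R -> Prop) : R -> Prop :=
  fun r => exists a b, I a /\ J b /\ r = a + b.

Definition colon_elt (I : R -> Prop) (a : R) : R -> Prop :=
  fun r => I (r * a).
Definition colon_set (I J : R -> Prop) : R -> Prop :=
  fun r => forall a, J a -> I (r * a).

Definition is_unit (a : R) : Prop := exists b, a * b = 1.
(* the set of non-units; the maximal ideal when R is local *)
Definition max_ideal : R -> Prop := fun a => ~ is_unit a.

Definition local_ring : Prop := is_ideal max_ideal.

Definition noetherian : Prop :=
  forall I : nat -> R -> Prop, (forall n, is_ideal (I n)) ->
    (forall n, subsetR (I n) (I n.+1)) ->
    exists N, forall n, (N <= n)%N -> eqsetR (I n) (I N).

Definition is_prime (P : R -> Prop) : Prop :=
  is_ideal P /\ ~ P 1 /\ (forall a b, P (a * b) -> P a \/ P b).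

Definition prime_chain (n : nat) : Prop :=
  exists P : nat -> R -> Prop, (forall k, (k <= n)%N -> is_prime (P k)) /\
    (forall k, (k < n)%N -> psubsetR (P k) (P k.+1)).

Definition krull_dim (d : nat) : Prop :=
  prime_chain d /\ forall n, prime_chain n -> (n <= d)%N.

Definition mpow (n : nat) : R -> Prop :=
  ideal_gen (fun r => exists f : 'I_n -> R,
                (forall i, max_ideal (f i)) /\ r = \prod_(i < n) f i).

Definition ord (x : R) : option nat := sup_nat (fun n => mpow n x).

(* ord_{R/J}(y) = sup { n | y ∈ m^n + J } (order of image in R/J) *)
Definition ord_quot (J : R -> Prop) (y : R) : option nat :=
  sup_nat (fun n => add_ideal (mpow n) J y).

(* ℓ_R(R/I): sup of lengths of strict chains of submodules of R/I,
   i.e. of ideals containing I *)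
Definition qlength (I : R -> Prop) : option nat :=
  sup_nat (fun n => exists J : nat -> R -> Prop,
     (forall k, (k <= n)%N -> is_ideal (J k) /\ subsetR I (J k)) /\
     (forall k, (k < n)%N -> psubsetR (J k) (J k.+1))).

(* system of parameters: dim R = size x elements of m generating an
   m-primary ideal *)
Definition sop (x : seq R) : Prop :=
  krull_dim (size x) /\ (forall i, (i < size x)%N -> max_ideal x`_i) /\
  exists n, subsetR (mpow n) (seq_ideal x).

Definition buchsbaum : Prop :=
  forall x : seq R, sop x -> forall i, (i < size x)%N ->
    eqsetR (colon_elt (seq_ideal (take i x)) x`_i)
           (colon_set (seq_ideal (take i x)) max_ideal).

End CommAlg.

(* Main.v *)
(* If R is Buchsbaum and l is the length of R/(x), then m^l <= (x), so an element
   sum x_i y_i of m^N with N > l can be rewritten as sum x_i w_i with all w_i in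
   m^(N-l). Then y_d - w_d lies in (x_1, ..., x_(d-1)) : x_d, which is
   (x_1, ..., x_(d-1)) : m, so y_d has order at least N - l modulo that colon.
   Hence phi(l, t) = l + t works.

   Conversely let r x_i lie in (x_1, ..., x_(i-1)). Then r also multiplies x_i
   into the ideal s of x_1, ..., x_(i-1), x_(i+1)^n, ..., x_d^n, and these
   together with x_i (put last) form a system of parameters. The resulting
   relation has order oo, so phi = oo, which forces r to have infinite order
   modulo s : m, as R/(s, x_i) has finite length; by Krull's intersection
   theorem r m <= s. Letting n grow, a second use of Krull's theorem yields
   r m <= (x_1, ..., x_(i-1)). *)
Require Import Defs.
From mathcomp Require Import all_boot all_order all_algebra.
From mathcomp Require Import zify ring.
From Stdlib Require Import Classical ClassicalEpsilon.
Import GRing.Theory.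
Local Open Scope ring_scope.

(** * Suprema of sets of natural numbers *)

Lemma sup_nat_Some {P : nat -> Prop} {b : nat} :
  sup_nat P = Some b -> forall n, P n -> (n <= b)%N.
Proof.
rewrite /sup_nat; case: excluded_middle_informative => // H [<-].
by case: ex_minnP => m /decbP.
Qed.

Lemma sup_nat_None {P : nat -> Prop} :
  sup_nat P = None -> forall b, exists2 n, P n & (b < n)%N.
Proof.
rewrite /sup_nat; case: excluded_middle_informative => // H _ b.
apply: NNPP => nex; apply: H; exists b => n Pn.
by rewrite leqNgt; apply/negP => lt_bn; apply: nex; exists n.
Qed.

Lemma sup_nat_unbounded (P : nat -> Prop) :
  (forall n, P n) -> sup_nat P = None.
Proof.
move=> allP; case E: (sup_nat P) => [b|] //.
by have := sup_nat_Some E b.+1 (allP _); rewrite ltnn.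
Qed.

Lemma le_inf_sup_nat (P : nat -> Prop) (c : nat) :
  (forall n, P n -> (n <= c)%N) -> le_inf (sup_nat P) (Some c).
Proof.
rewrite /sup_nat => Pc; case: excluded_middle_informative => [H|[]]; last first.
  by exists c.
by case: ex_minnP => m _ /(_ c); apply; apply/decbP.
Qed.

(** * Ideals, generators and radicals *)

Section Ideals.
Variable R : comNzRingType.
Implicit Types (I J K : R -> Prop) (s : seq R) (a b g r : R).

Lemma ideal0 {I} : is_ideal I -> I 0.
Proof. by case. Qed.

Lemma idealD {I a b} : is_ideal I -> I a -> I b -> I (a + b).
Proof. by case=> _ [+ _]; apply. Qed.

Lemma idealMl {I} r {a} : is_ideal I -> I a -> I (r * a).
Proof. by case=> _ [_]; apply. Qed.

Lemma idealMr {I} r {a} : is_ideal I -> I a -> I (a * r).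
Proof. by rewrite mulrC; apply: idealMl. Qed.

Lemma idealN {I a} : is_ideal I -> I a -> I (- a).
Proof. by move=> iI /(idealMl (-1) iI); rewrite mulN1r. Qed.

Lemma idealB {I a b} : is_ideal I -> I a -> I b -> I (a - b).
Proof. by move=> iI Ia Ib; apply: idealD (idealN iI Ib). Qed.

Lemma ideal_sum I n (F : 'I_n -> R) :
  is_ideal I -> (forall i, I (F i)) -> I (\sum_(i < n) F i).
Proof.
move=> iI IF; apply: (big_ind I) => //; first exact: ideal0.
by move=> a b; apply: idealD.
Qed.

Lemma ideal_gen_ideal (S : R -> Prop) : is_ideal (ideal_gen S).
Proof.
split; first by move=> I iI _; apply: ideal0.
split=> [a b Ha Hb I iI SI | r a Ha I iI SI].
  by apply: idealD (Ha I iI SI) (Hb I iI SI).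
exact: idealMl (Ha I iI SI).
Qed.

Lemma sub_ideal_gen (S : R -> Prop) : subsetR S (ideal_gen S).
Proof. by move=> r Sr I _; apply. Qed.

Lemma seq_ideal_ideal s : is_ideal (seq_ideal s).
Proof. exact: ideal_gen_ideal. Qed.

Lemma seq_ideal_nth s i : (i < size s)%N -> seq_ideal s s`_i.
Proof. by move=> lt_is; apply: sub_ideal_gen; exists i. Qed.

Lemma seq_ideal_mem s a : a \in s -> seq_ideal s a.
Proof. by move=> /(nthP 0)[i lt_is <-]; apply: seq_ideal_nth. Qed.

Lemma seq_ideal_sub s I :
  is_ideal I -> (forall a, a \in s -> I a) -> subsetR (seq_ideal s) I.
Proof.
by move=> iI sI r; apply=> // _ [i lt_is ->]; apply: sI; apply: mem_nth.
Qed.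

Lemma seq_idealP s r :
  seq_ideal s r <-> exists c : nat -> R, r = \sum_(i < size s) s`_i * c i.
Proof.
pose I r := exists c : nat -> R, r = \sum_(i < size s) s`_i * c i.
split=> [Hr|[c ->]]; last first.
  apply: (ideal_sum _ _ _ (seq_ideal_ideal s)) => i.
  by apply: idealMr (seq_ideal_ideal s) _; apply: seq_ideal_nth.
apply: (Hr I) => [|_ [i lt_is ->]]; last first.
  exists (fun j => (j == i)%:R).
  rewrite (bigD1 (Ordinal lt_is)) //= eqxx mulr1 big1 ?addr0 // => j.
  by rewrite -val_eqE /= => /negPf ->; rewrite mulr0.
split; first by exists (fun=> 0); rewrite big1 // => i _; rewrite mulr0.
split=> [_ _ [c ->] [e ->] | t _ [c ->]].
  exists (fun i => c i + e i); rewrite -big_split; apply: eq_bigr => i _.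
  by rewrite /= mulrDr.
by exists (fun i => t * c i); rewrite mulr_sumr; apply: eq_bigr => i _; ring.
Qed.

Lemma add_ideal_ideal I J : is_ideal I -> is_ideal J -> is_ideal (add_ideal I J).
Proof.
move=> iI iJ; split; first by exists 0, 0; rewrite addr0; do !split; apply: ideal0.
split=> [_ _ [a [b [Ia [Jb ->]]]] [a' [b' [Ia' [Jb' ->]]]]
        | r _ [a [b [Ia [Jb ->]]]]].
  by exists (a + a'), (b + b'); do !split; [apply: idealD..|ring].
by exists (r * a), (r * b); do !split; [apply: idealMl..|ring].
Qed.

Lemma add_idealSl I J : is_ideal J -> subsetR I (add_ideal I J).
Proof. by move=> iJ a Ia; exists a, 0; rewrite addr0; do !split=> //; apply: ideal0. Qed.

Lemma add_idealSr I J : is_ideal I -> subsetR J (add_ideal I J).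
Proof. by move=> iI a Ja; exists 0, a; rewrite add0r; do !split=> //; apply: ideal0. Qed.

Lemma add_ideal_sub I J K :
  is_ideal K -> subsetR I K -> subsetR J K -> subsetR (add_ideal I J) K.
Proof. by move=> iK IK JK _ [a [b [/IK Ka [/JK Kb ->]]]]; apply: idealD. Qed.

Lemma colon_set_ideal I J : is_ideal I -> is_ideal (colon_set I J).
Proof.
move=> iI; split; first by move=> a _; rewrite mul0r; apply: ideal0.
split=> [a b Ha Hb c Jc | r a Ha c Jc].
  by rewrite mulrDl; apply: idealD (Ha _ Jc) (Hb _ Jc).
by rewrite -mulrA; apply: idealMl (Ha _ Jc).
Qed.

(** The ideal I + (g), with the coefficient of g kept explicit. *)
Definition adjoin I g : R -> Prop := fun r => exists a c, I a /\ r = a + c * g.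

Lemma adjoin_ideal I g : is_ideal I -> is_ideal (adjoin I g).
Proof.
move=> iI; split; first by exists 0, 0; split; [apply: ideal0|ring].
split=> [_ _ [a [c [Ia ->]]] [a' [c' [Ia' ->]]] | r _ [a [c [Ia ->]]]].
  by exists (a + a'), (c + c'); split; [apply: idealD|ring].
by exists (r * a), (r * c); split; [apply: idealMl|ring].
Qed.

Lemma sub_adjoin I g : subsetR I (adjoin I g).
Proof. by move=> a Ia; exists a, 0; split=> //; ring. Qed.

Lemma mem_adjoin I g : is_ideal I -> adjoin I g g.
Proof. by move=> iI; exists 0, 1; split; [apply: ideal0|ring]. Qed.

Lemma adjoin_sub I J g :
  is_ideal J -> subsetR I J -> J g -> subsetR (adjoin I g) J.
Proof.
by move=> iJ IJ Jg _ [a [c [/IJ Ja ->]]]; apply: idealD Ja _ => //; apply: idealMl.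
Qed.

Definition radical I : R -> Prop := fun a => exists n, I (a ^+ n).

Lemma ideal_exp_leq I a m n :
  is_ideal I -> (m <= n)%N -> I (a ^+ m) -> I (a ^+ n).
Proof. by move=> iI le_mn; rewrite -(subnK le_mn) exprD; apply: idealMl. Qed.

Lemma radical_ideal I : is_ideal I -> is_ideal (radical I).
Proof.
move=> iI; split; first by exists 1%N; rewrite expr1; apply: ideal0.
split=> [a b [m Im] [n In] | r a [n In]]; last first.
  by exists n; rewrite exprMn; apply: idealMl.
exists (m + n)%N; rewrite exprDn; apply: ideal_sum => // i.
(* In each term of (a + b)^(m + n), either b has exponent at least n or a has exponent at least
   m. *)
rewrite -mulr_natl; apply: idealMl => //; have [le_ni|lt_in] := leqP n i.
  by apply: idealMl => //; apply: ideal_exp_leq le_ni In.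
by apply: idealMr => //; apply: ideal_exp_leq Im => //; lia.
Qed.

(** Without a maximal element, choice would give every such ideal a strictly larger one, and
    iterating from [I] would break the ascending chain condition. *)
Lemma noetherian_max (P : (R -> Prop) -> Prop) I :
  noetherian R -> is_ideal I -> P I ->
  exists M, is_ideal M /\ P M /\
    forall K, is_ideal K -> P K -> subsetR M K -> subsetR K M.
Proof.
move=> noeR iI PI; apply: NNPP => nomax.
pose T := {K | is_ideal K /\ P K}.
have bigger (K : T) : exists L : T, psubsetR (sval K) (sval L).
  case: K => K [iK PK]; apply: NNPP => nL; apply: nomax; exists K.
  split=> //; split=> // L iL PL KL; apply: NNPP => nLK.
  by apply: nL; exists (exist _ L (conj iL PL)).
pose f t := sval (constructive_indefinite_description _ (bigger t)).
have fP t : psubsetR (sval t) (sval (f t)).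
  by rewrite /f; case: constructive_indefinite_description.
pose c n := iter n f (exist _ I (conj iI PI)).
have [||N cN] := noeR (fun n => sval (c n)).
- by move=> n; case: (c n) => K [].
- by move=> n; case: (fP (c n)).
by case: (fP (c N)) => _ []; move=> r /(cN N.+1 (leqnSn N)).
Qed.

(** * Powers of the maximal ideal *)

Local Notation m := (@max_ideal R).

Lemma mpow_ideal n : is_ideal (@mpow R n).
Proof. exact: ideal_gen_ideal. Qed.

Lemma mpow_prod n (f : 'I_n -> R) :
  (forall i, m (f i)) -> mpow n (\prod_(i < n) f i).
Proof. by move=> mf; apply: sub_ideal_gen; exists f. Qed.

Lemma mpow0 r : mpow 0 r.
Proof.
rewrite -[r]mulr1; apply: idealMl (mpow_ideal 0) _.
suff <- : \prod_(i < 0) (0 : R) = 1 by apply: mpow_prod; case.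
by rewrite big_ord0.
Qed.

Lemma mpow_exp n a : m a -> mpow n (a ^+ n).
Proof.
move=> ma; suff <- : \prod_(i < n) a = a ^+ n by apply: mpow_prod.
by rewrite prodr_const card_ord.
Qed.

Lemma mpowD_sub p q I :
  is_ideal I -> (forall a b, mpow p a -> mpow q b -> I (a * b)) ->
  subsetR (@mpow R (p + q)) I.
Proof.
move=> iI HI r; apply=> // _ [f [mf ->]].
by rewrite big_split_ord /=; apply: HI; apply: mpow_prod.
Qed.

Lemma mpow_leq p q : (p <= q)%N -> subsetR (@mpow R q) (mpow p).
Proof.
move=> le_pq; rewrite -(subnK le_pq); apply: mpowD_sub (mpow_ideal p) _.
by move=> a b _; apply: idealMl (mpow_ideal p).
Qed.

Lemma mpowD p q a b : mpow p a -> mpow q b -> mpow (p + q) (a * b).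
Proof.
move=> pa qb; rewrite mulrC.
(* Membership in [mpow] is used by testing an ideal on generators: [A] quantifies over all of m^q,
   so a may be taken to be a product; [B] then does the same for b. *)
pose A c := forall b, mpow q b -> mpow (p + q) (b * c).
suff: A a by apply.
have iM := mpow_ideal (p + q).
apply: pa => [|_ [f [mf ->]] {b qb} b qb].
  split; first by move=> c _; rewrite mulr0; apply: ideal0.
  split=> [c e Ac Ae | t c Ac] z qz.
    by rewrite mulrDr; apply: idealD (Ac _ qz) (Ae _ qz).
  by rewrite mulrCA; apply: idealMl (Ac _ qz).
rewrite mulrC.
pose B c := mpow (p + q) ((\prod_(i < p) f i) * c).
suff: B b by [].
apply: qb => [|_ [h [mh ->]]].
  rewrite /B; split; first by rewrite mulr0; apply: ideal0.
  split=> [c e Bc Be | t c Bc]; first by rewrite mulrDr; apply: idealD iM Bc Be.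
  by rewrite mulrCA; apply: idealMl iM Bc.
rewrite /B; pose F k := match split k with inl i => f i | inr j => h j end.
suff <- : \prod_(k < p + q) F k = \prod_(i < p) f i * \prod_(j < q) h j.
  by apply: mpow_prod => k; rewrite /F; case: split.
rewrite big_split_ord /=; congr (_ * _); apply: eq_bigr => i _.
  by rewrite /F (unsplitK (inl _ i)).
by rewrite /F (unsplitK (inr _ i)).
Qed.

Hypothesis localR : local_ring R.

Lemma mpow1_sub : subsetR (@mpow R 1) m.
Proof. move=> r r1; refine (r1 m localR _) => _ [f [mf ->]].
by rewrite big_ord1; exact: mf. Qed.

(** Otherwise 1 = a + (1 - a) would lie in the ideal of non-units. *)
Lemma exists_inv_onem a : m a -> exists b, b * (1 - a) = 1.
Proof.
move=> ma; have [[b bE]|nu] := classic (is_unit (1 - a)).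
  by exists b; rewrite mulrC.
case: (idealD localR ma nu); exists 1; ring.
Qed.

Lemma ideal_onem I a g : is_ideal I -> m a -> I ((1 - a) * g) -> I g.
Proof.
move=> iI /exists_inv_onem[b bE] /(idealMl b iI).
by rewrite mulrA bE mul1r.
Qed.

(** * Krull's intersection theorem *)

Hypothesis noeR : noetherian R.

(* In a maximal counterexample some g has g not in I and g^2 in I; then
   m^N <= I + (g) gives m^(2N) <= I. *)
Lemma mpow_sub_of_radical I :
  is_ideal I -> subsetR m (radical I) -> exists n, subsetR (mpow n) I.
Proof.
move=> iI radI; apply: NNPP => bad.
have [|M [iM [[radM badM] maxM]]] :=
  noetherian_max (fun I => subsetR m (radical I) /\
                           ~ exists n, subsetR (mpow n) I) I noeR iI.
  by [].
have [a [ma nMa]] : exists a, m a /\ ~ M a.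
  apply: NNPP => nex; apply: badM; exists 1%N => a /mpow1_sub ma.
  by apply: NNPP => nMa; apply: nex; exists a.
have [g [nMg Mg2]] : exists g, ~ M g /\ M (g * g).
  have [n Mn] := radM a ma.
  have exn : exists n, decb (M (a ^+ n)) by exists n; apply/decbP.
  case: (ex_minnP exn) => -[|[|k]] /decbP Mk mink.
  - by case: nMa; rewrite -[a]mulr1; apply: idealMl.
  - by case: nMa; rewrite -[a]expr1.
  (* Here k + 2 is the least exponent of a power of a in M, and 2(k + 1) >= k + 2. *)
  exists (a ^+ k.+1); split; first by move=> /decbP /mink; rewrite ltnn.
  by rewrite -exprD; apply: ideal_exp_leq Mk => //; lia.
have iMg := adjoin_ideal M g iM.
have [n nP] : exists n, subsetR (mpow n) (adjoin M g).
  apply: NNPP => bad'; apply: nMg.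
  apply: (maxM (adjoin M g)) (mem_adjoin _ _ iM) => //; last exact: sub_adjoin.
  by split=> // b /radM[n Mb]; exists n; apply: sub_adjoin.
apply: badM; exists (n + n)%N; apply: mpowD_sub => // _ _ /nP[a1 [c1 [M1 ->]]]
  /nP[a2 [c2 [M2 ->]]].
have -> : (a1 + c1 * g) * (a2 + c2 * g) =
  (a2 + c2 * g) * a1 + (c1 * g * a2 + c1 * c2 * (g * g)) by ring.
by apply: idealD => //; [|apply: idealD => //]; apply: idealMl.
Qed.

(* If a is not in J, let K be maximal among the ideals containing J but not a.
   Then m a <= K, and for x in m the chain K : x^n stabilizes; this forces some
   x^n into K. Hence K contains a power of m, and a is not in m^n + J. *)
Lemma krull_intersection J a :
  is_ideal J -> (forall n, add_ideal (mpow n) J a) -> J a.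
Proof.
move=> iJ allJ; apply: NNPP => nJa.
have [|K [iK [[JK nKa] maxK]]] :=
  noetherian_max (fun I => subsetR J I /\ ~ I a) J noeR iJ; first by split=> // r.
have avoid g : ~ K g -> adjoin K g a.
  move=> nKg; apply: NNPP => nga; apply: nKg.
  apply: (maxK (adjoin K g)) (mem_adjoin _ _ iK); first exact: adjoin_ideal.
    by split=> // r /JK Kr; apply: sub_adjoin.
  exact: sub_adjoin.
have mK x : m x -> K (x * a).
  (* If x a were outside K, then a = k + c x a with k in K, where 1 - c x is a unit. *)
  move=> mx; apply: NNPP => /avoid[k [c [Kk aE]]]; apply: nKa.
  apply: (ideal_onem K (c * x)) => //; first exact: idealMl.
  suff -> : (1 - c * x) * a = k by [].
  by rewrite mulrBl mul1r -mulrA {1}aE; ring.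
have [|n nP] := mpow_sub_of_radical K iK.
- move=> x mx; have [||n nP] := noeR (fun n => colon_elt K (x ^+ n)).
  + move=> n; rewrite /colon_elt; split; first by rewrite mul0r; apply: ideal0.
    split=> [b c Kb Kc | r b Kb]; first by rewrite mulrDl; apply: idealD.
    by rewrite -mulrA; apply: idealMl.
  + by move=> n r; rewrite /colon_elt exprS mulrCA; apply: idealMl.
  (* If a = k + c x^n, then x a in K gives c in K : x^(n+1) = K : x^n, so a is in K. *)
  exists n; apply: NNPP => /avoid[k [c [Kk aE]]]; apply: nKa.
  rewrite aE; apply: idealD => //; apply/(nP n.+1 (leqnSn n)).
  rewrite /colon_elt; have -> : c * x ^+ n.+1 = x * a - x * k.
    by rewrite aE exprS; ring.
  by apply: idealB => //; [apply: mK|apply: idealMl].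
by apply: nKa; apply: (add_ideal_sub _ _ _ iK nP JK); apply: allJ.
Qed.

(** An infinite [ord_quot] provides only unbounded exponents; as the powers of m decrease, these
    suffice. *)
Lemma krull_intersection_cofinal J a :
  is_ideal J ->
  (forall b : nat, exists2 n, add_ideal (mpow n) J a & (b < n)%N) -> J a.
Proof.
move=> iJ H; apply: krull_intersection => // n; have [k + lt_nk] := H n.
move=> [u [v [mu [Jv ->]]]]; exists u, v; do !split=> //.
exact: mpow_leq (ltnW lt_nk) _ mu.
Qed.

(** * Lengths of quotients by ideals containing a power of m *)

Definition ideal_chain I n (J : nat -> R -> Prop) : Prop :=
  (forall k, (k <= n)%N -> is_ideal (J k) /\ subsetR I (J k)) /\
  (forall k, (k < n)%N -> psubsetR (J k) (J k.+1)).

(* Adding a socle element g to a chain over I costs at most one strict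
   inclusion: J_k + (g) = J_(k+1) + (g) forces g to enter between the two. *)
Lemma ideal_chain_adjoin I g n (J : nat -> R -> Prop) :
  is_ideal I -> (forall a, m a -> I (a * g)) -> ideal_chain I n.+1 J ->
  exists J' : nat -> R -> Prop, ideal_chain (adjoin I g) n J'.
Proof.
move=> iI socg [iJ sJ].
have key k : (k < n.+1)%N -> ~ J k.+1 g -> ~ subsetR (J k.+1) (adjoin (J k) g).
  move=> lt_kn nJg sub; have [JJ []] := sJ k lt_kn => r Jr.
  have [iJk IJk] := iJ k (ltnW lt_kn); have [iJk1 _] := iJ k.+1 lt_kn.
  have [a [c [Ja rE]]] := sub r Jr.
  (* If c is a non-unit, c g lies in I; if c is a unit, g lies in J_(k+1). *)
  rewrite rE; apply: idealD => //; apply: IJk; apply: socg => -[b bE].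
  apply: nJg; have -> : g = b * (r - a).
    by rewrite rE addrC addKr mulrA [b * c]mulrC bE mul1r.
  by apply: idealMl => //; apply: idealB => //; apply: JJ.
(* J_k + (g) as long as g is not in J_(k+1), and J_(k+1) afterwards; this skips exactly one
   index. *)
exists (fun k => if decb (J k.+1 g) then J k.+1 else adjoin (J k) g).
split=> k le_kn.
  have [iJk IJk] := iJ k (leqW le_kn); have [iJk1 IJk1] := iJ k.+1 le_kn.
  case: ifP => [/decbP Jg|_]; split=> //; first exact: adjoin_sub.
    exact: adjoin_ideal.
  apply: adjoin_sub; [exact: adjoin_ideal| |exact: mem_adjoin].
  by move=> r /IJk Jr; apply: sub_adjoin.
have lt_kn1 : (k < n.+1)%N by apply: ltnW.
have [J01 _] := sJ k lt_kn1; have [J12 nJ21] := sJ k.+1 le_kn.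
have [iJ1 _] := iJ k.+1 lt_kn1; have [iJ2 _] := iJ k.+2 le_kn.
case: (boolP (decb (J k.+1 g))) => [/decbP J1g|/negP nJ1].
  by rewrite (proj2 (decbP _) (J12 _ J1g)).
have {}nJ1 : ~ J k.+1 g by move=> /decbP.
case: (boolP (decb (J k.+2 g))) => [/decbP J2g|/negP nJ2].
  split; first by apply: adjoin_sub => // r /J01/J12.
  by move=> sub; apply: (key k lt_kn1 nJ1) => r /J12/sub.
have {}nJ2 : ~ J k.+2 g by move=> /decbP.
split.
  apply: adjoin_sub (mem_adjoin _ _ iJ1); first exact: adjoin_ideal.
  by move=> r /J01 Jr; apply: sub_adjoin.
by move=> sub; apply: (key k lt_kn1 nJ1) => r Jr; apply/sub/sub_adjoin.
Qed.

(** If n is least with m^n <= I, any element of m^(n-1) outside I is killed by m modulo I. *)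
Lemma exists_socle I n :
  is_ideal I -> subsetR (mpow n) I -> ~ I 1 ->
  exists g, ~ I g /\ forall a, m a -> I (a * g).
Proof.
move=> iI; elim: n => [|n IHn] nI nI1; first by case: nI1; apply: nI; apply: mpow0.
have [/IHn|nnI] := classic (subsetR (mpow n) I); first exact.
have [g [ng nIg]] : exists g, mpow n g /\ ~ I g.
  apply: NNPP => nex; apply: nnI => g ng.
  by apply: NNPP => nIg; apply: nex; exists g.
exists g; split=> // a ma; apply: nI; rewrite -add1n.
by apply: mpowD => //; rewrite -[a]expr1; apply: mpow_exp.
Qed.

(** Take an ideal maximal among those over m^n with arbitrarily long chains. Adjoining a socle
    element shortens a chain by at most one, so the larger ideal has arbitrarily long chains too. *)
Lemma qlength_finite I n :
  is_ideal I -> subsetR (mpow n) I -> qlength I <> None.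
Proof.
move=> iI nI /sup_nat_None unbI.
have [|M [iM [[nM unbM] maxM]]] :=
  noetherian_max (fun I => subsetR (mpow n) I /\
    forall b : nat,
      exists2 k, exists J : nat -> R -> Prop, ideal_chain I k J & (b < k)%N)
    I noeR iI.
  by [].
have [|g [nMg socg]] := exists_socle M n iM nM.
  move=> M1; have allM r : M r by rewrite -[r]mulr1; apply: idealMl.
  have [[|k] [J [JM sJ]] // _] := unbM 0%N.
  have [_ []] := sJ 0%N isT; move=> r _.
  by have [_ MJ] := JM 0%N isT; apply/MJ/allM.
apply: nMg; apply: (maxM (adjoin M g)) (mem_adjoin _ _ iM).
- exact: adjoin_ideal.
- split=> [r /nM|b]; first exact: sub_adjoin.
  have [[|k] // [J chJ] lt_bk] := unbM b.+1.
  by exists k => //; apply: ideal_chain_adjoin chJ.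
- exact: sub_adjoin.
Qed.

(* The ideals m^k + I descend strictly from R until they reach I. *)
Lemma mpow_qlength_sub I n l :
  is_ideal I -> subsetR (mpow n) I -> qlength I = Some l ->
  subsetR (mpow l) I.
Proof.
move=> iI nI /sup_nat_Some lenI; apply: NNPP => nlI.
pose A k := add_ideal (@mpow R k) I.
have iA k : is_ideal (A k) by apply: add_ideal_ideal => //; apply: mpow_ideal.
have AS k : subsetR (A k.+1) (A k).
  move=> _ [a [b [ka [Ib ->]]]]; exists a, b; do !split=> //.
  exact: mpow_leq ka.
have strict k : (k <= l)%N -> ~ subsetR (A k) (A k.+1).
  move=> le_kl sub; apply: nlI.
  (* If m^k + I = m^(k+1) + I, multiplying by m^j pushes m^k into m^(k+j) + I for all j, hence into
     I for j = n. *)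
  have step j : subsetR (mpow k) (A (k + j)%N).
    elim: j => [|j IHj] r kr.
      by rewrite addn0; apply: add_idealSl kr.
    have [u [v [ku [Iv ->]]]] := IHj r kr.
    apply: idealD => //; last by apply: add_idealSr => //; apply: mpow_ideal.
    apply: (mpowD_sub _ _ _ (iA _)) ku => a b ka jb.
    have /sub[u' [v' [ku' [Iv' ->]]]] : A k a by apply: add_idealSl.
    rewrite mulrDl; exists (u' * b), (v' * b); do !split.
    + by rewrite addnS -addSn; apply: mpowD.
    + by apply: idealMr.
  move=> r /(mpow_leq _ _ le_kl) /(step n).
  apply: add_ideal_sub => // a kna; apply: nI.
  by apply: mpow_leq kna; apply: leq_addl.
suff /lenI : exists J : nat -> R -> Prop, ideal_chain I l.+1 J by rewrite ltnn.
(* The chain I < m^l + I < ... < m^0 + I has l + 1 strict inclusions, one too many. *)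
exists (fun k => if k is k'.+1 then A (l - k')%N else I).
split=> [[|k] le_kl|[|k] lt_kl].
- by split=> // r.
- by split=> //; apply: add_idealSr; apply: mpow_ideal.
- rewrite subn0; split; first by apply: add_idealSr; apply: mpow_ideal.
  by move=> sub; apply: nlI => r lr; apply/sub/add_idealSl.
- have -> : (l - k)%N = (l - k.+1).+1 by lia.
  by split; [apply: AS|apply: strict; lia].
Qed.

(** * Changing systems of parameters *)

Lemma sop_rotate_powers (x : seq R) i n :
  (i < size x)%N -> (0 < n)%N -> sop x ->
  sop (rcons (take i x ++ [seq a ^+ n | a <- drop i.+1 x]) x`_i).
Proof.
move=> lt_ix n_gt0 [dimx [mx [k kx]]]; set x' := rcons _ _.
have ix' := seq_ideal_ideal x'.
have xE : x = take i x ++ x`_i :: drop i.+1 x.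
  by rewrite -drop_nth // cat_take_drop.
have szx : size x' = size x.
  by rewrite size_rcons size_cat size_map size_takel ?size_drop; lia.
have mx_in a : a \in x -> m a by move=> /(nthP 0)[j lt_j <-]; apply: mx.
split; first by rewrite szx.
split=> [j lt_j|].
  have : x'`_j \in x' by apply: mem_nth.
  rewrite mem_rcons inE mem_cat => /orP[/eqP-> | /orP[/mem_take|]].
  - exact: mx.
  - exact: mx_in.
  - move=> /mapP[a /mem_drop/mx_in ma ->].
    by rewrite -(prednK n_gt0) exprS; apply: idealMr localR ma.
(* It suffices that m lies in the radical of (x'): a^k lies in (x), and each generator of (x) has a
   power in (x'). *)
apply: mpow_sub_of_radical => // a ma.
have [p] : radical (radical (seq_ideal x')) a.
  exists k; apply: (seq_ideal_sub x) (kx _ (mpow_exp _ _ ma)).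
    exact: radical_ideal.
  move=> b; rewrite {1}xE mem_cat inE => /or3P[bx | /eqP-> | bx].
  - exists 1%N; rewrite expr1; apply: seq_ideal_mem.
    by rewrite mem_rcons inE mem_cat bx orbT.
  - by exists 1%N; rewrite expr1; apply: seq_ideal_mem; rewrite mem_rcons mem_head.
  - exists n; apply: seq_ideal_mem.
    by rewrite mem_rcons inE mem_cat (map_f (fun a => a ^+ n) bx) !orbT.
by case=> q; rewrite -exprM => Hq; exists (p * q)%N.
Qed.

(** * From the order bound to the Buchsbaum property *)

Definition ord_bound d (phi : option nat -> option nat -> option nat) : Prop :=
  forall x y : d.-tuple R, sop (x : seq R) ->
    le_inf (ord (\sum_(i < d) x`_i * y`_i))
           (phi (qlength (seq_ideal (x : seq R)))
                (ord_quot (colon_set (seq_ideal (take d.-1 x)) m)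
                          (last 0 (y : seq R)))).

(* A relation sum x_i y_i = 0 has order oo, so the bound forces y_d to have
   infinite order modulo (x_1, ..., x_(d-1)) : m. *)
Lemma colon_elt_last s a phi :
  numerical2 phi -> ord_bound (size s).+1 phi -> sop (rcons s a) ->
  subsetR (colon_elt (seq_ideal s) a) (colon_set (seq_ideal s) m).
Proof.
move=> numphi bound sopx r Hr.
have iC : is_ideal (colon_set (seq_ideal s) m).
  exact/colon_set_ideal/seq_ideal_ideal.
(* The sign turns (c, r) into a relation: the sum of s_j c_j plus a r is 0. *)
have /seq_idealP[c cE] := idealN (seq_ideal_ideal s) Hr.
have szx : size (rcons s a) == (size s).+1 by rewrite size_rcons.
have szy : size (rcons (mkseq c (size s)) r) == (size s).+1.
  by rewrite size_rcons size_mkseq.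
have := bound (Tuple szx) (Tuple szy) sopx.
have -> : \sum_(i < (size s).+1) (Tuple szx)`_i * (Tuple szy)`_i = 0.
  rewrite big_ord_recr /= !nth_rcons size_mkseq ltnn eqxx.
  rewrite (eq_bigr (fun i : 'I_(size s) => s`_i * c i)) => [|i _].
    by rewrite -cE; ring.
  by rewrite !nth_rcons size_mkseq ltn_ord nth_mkseq.
rewrite /ord sup_nat_unbounded => [|n]; last exact/ideal0/mpow_ideal.
rewrite /= last_rcons -cats1 take_size_cat // cats1.
case E: (phi _ _) => [//|] _; move/numphi: E => [].
  have [_ [_ [n nx]]] := sopx.
  by move=> /(qlength_finite _ n (seq_ideal_ideal _) nx).
by move=> /sup_nat_None; apply: krull_intersection_cofinal.
Qed.

Lemma buchsbaum_of_ord_bound d phi :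
  krull_dim R d -> (0 < d)%N -> numerical2 phi -> ord_bound d phi -> buchsbaum R.
Proof.
move=> [chd maxd] d_gt0 numphi bound x sopx i lt_ix r.
split=> [Hr a ma|]; last by apply; case: sopx => _ [mx _]; apply: mx.
apply: krull_intersection_cofinal; first exact: seq_ideal_ideal.
move=> b; exists b.+1 => //.
(* The exponent b + 1 is positive, as [sop_rotate_powers] requires, and puts the powers into
   m^(b+1). *)
pose s := take i x ++ [seq a ^+ b.+1 | a <- drop i.+1 x].
have sop' : sop (rcons s x`_i) by apply: sop_rotate_powers.
(* The Krull dimension is unique, so the bound for d-tuples applies to the new system. *)
have dE : (size s).+1 = d.
  case: sop' => [[chs maxs] _]; rewrite size_rcons in chs maxs.
  by apply/eqP; rewrite eqn_leq maxd // maxs.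
have bound' : ord_bound (size s).+1 phi by rewrite dE.
have [mx_ _] := proj2 sopx.
have sr : colon_elt (seq_ideal s) x`_i r.
  apply: (seq_ideal_sub (take i x)) Hr; first exact: seq_ideal_ideal.
  by move=> t tx; apply: seq_ideal_mem; rewrite mem_cat tx.
have := colon_elt_last _ _ _ numphi bound' sop' r sr a ma.
have iM := mpow_ideal b.+1.
apply: seq_ideal_sub => [|t].
  by apply: add_ideal_ideal => //; apply: seq_ideal_ideal.
rewrite mem_cat => /orP[tx|].
  by apply: add_idealSr => //; apply: seq_ideal_mem.
move=> /mapP[z /mem_drop/(nthP 0)[j lt_j <-] ->].
apply: add_idealSl; first exact: seq_ideal_ideal.
exact: mpow_exp (mx_ _ lt_j).
Qed.

(** * From the Buchsbaum property to the order bound *)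

Lemma buchsbaum_ord_bound d (x y : d.-tuple R) l t :
  buchsbaum R -> (0 < d)%N -> sop (x : seq R) ->
  qlength (seq_ideal x) = Some l ->
  ord_quot (colon_set (seq_ideal (take d.-1 x)) m) (last 0 y) = Some t ->
  le_inf (ord (\sum_(i < d) x`_i * y`_i)) (Some (l + t)%N).
Proof.
move=> buch d_gt0 sopx lenx ordy; apply: le_inf_sup_nat => n nz.
rewrite leqNgt; apply/negP => lt_n.
have [_ [_ [k kx]]] := sopx.
have lx := mpow_qlength_sub _ _ _ (seq_ideal_ideal x) kx lenx.
(* The product ideal m^(n-l) (x), which contains m^n since m^l <= (x). *)
pose A r := exists2 w : nat -> R,
  forall i, mpow (n - l) (w i) & r = \sum_(i < d) x`_i * w i.
have iM := mpow_ideal (n - l).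
have iA : is_ideal A.
  split.
    exists (fun=> 0); first by move=> _; apply: ideal0.
    by rewrite big1 // => i; rewrite mulr0.
  split=> [_ _ [w mw ->] [v mv ->]|r _ [w mw ->]].
    exists (fun i => w i + v i); first by move=> i; apply: idealD iM (mw i) (mv i).
    by rewrite -big_split; apply: eq_bigr => i _; rewrite /= mulrDr.
  exists (fun i => r * w i); first by move=> i; apply: idealMl iM (mw i).
  by rewrite mulr_sumr; apply: eq_bigr => i _; ring.
have [w mw zE] : A (\sum_(i < d) x`_i * y`_i).
  have nE : n = (n - l + l)%N by lia.
  rewrite nE in nz; apply: mpowD_sub nz => // a b ma /lx/seq_idealP[c ->].
  exists (fun i => a * c i); first by move=> i; apply: idealMr iM ma.
  by rewrite size_tuple mulr_sumr; apply: eq_bigr => i _; ring.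
have lt_d : (d.-1 < size x)%N by rewrite size_tuple prednK.
(* Comparing the two sums, (y_d - w_d) x_d is the sum of x_i (w_i - y_i) over i < d. *)
have : colon_elt (seq_ideal (take d.-1 x)) x`_d.-1 (y`_d.-1 - w d.-1).
  apply/seq_idealP; exists (fun i => w i - y`_i).
  rewrite size_takel ?size_tuple ?leq_pred //.
  have recr (F : nat -> R) : \sum_(i < d) F i = \sum_(i < d.-1) F i + F d.-1.
    by case: (d) d_gt0 => // e _; rewrite big_ord_recr.
  rewrite (recr (fun i => x`_i * y`_i)) (recr (fun i => x`_i * w i)) in zE.
  under eq_bigr => i _ do rewrite nth_take // mulrBr.
  rewrite sumrB; apply/eqP; rewrite -subr_eq0; apply/eqP.
  by move/eqP: zE; rewrite -subr_eq0 => /eqP zE; rewrite -[RHS]zE; ring.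
move=> /(buch x sopx _ lt_d) colyw.
have : (n - l <= t)%N.
  apply: (sup_nat_Some ordy); exists (w d.-1), (y`_d.-1 - w d.-1).
  by split; [exact: mw|split=> //; rewrite -nth_last size_tuple; ring].
by lia.
Qed.

End Ideals.

Theorem theorem5p4 (R : comNzRingType) (d : nat) :
  noetherian R -> local_ring R -> krull_dim R d -> (0 < d)%N ->
  (buchsbaum R <->
   exists phi : option nat -> option nat -> option nat,
     numerical2 phi /\
     forall x y : d.-tuple R, sop (x : seq R) ->
       le_inf (ord (\sum_(i < d) x`_i * y`_i))
              (phi (qlength (seq_ideal (x : seq R)))
                   (ord_quot (colon_set (seq_ideal (take d.-1 x)) (@max_ideal R))
                             (last 0 (y : seq R))))).
Proof.
move=> noeR localR dimR d_gt0; split=> [buch|[phi [numphi bound]]]; last first.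
  exact: (buchsbaum_of_ord_bound _ localR noeR d phi).
(* Outside finite pairs [numerical2] forces the value oo, and there the bound is trivial. *)
exists (fun a b => if (a, b) is (Some l, Some t) then Some (l + t)%N else None).
split=> [[l|] [t|]|x y sopx]; try by split; [auto|case].
case El: (qlength _) => [l|]; last by case: (ord _).
case Et: (ord_quot _ _) => [t|]; last by case: (ord _).
exact: buchsbaum_ord_bound buch d_gt0 sopx El Et.
Qed.
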